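(* Let $K$ be an algebraically closed field of characteristic zero, and let $f:K[x,y]\to K[x,y]$ be a $K$-algebra endomorphism such that $\mathrm{Jac}(f(x),f(y))\in K^*$. Put $P=f(x)$, $Q=f(y)$, and let $K[P,Q][x+y]$ be the $K$-subalgebra of $K[x,y]$ generated by $P,Q,x+y$. If $K[P,Q][x+y]$ is a regular ring, then $f$ is invertible.
   Context: A commutative ring is regular if it is Noetherian and its localization at every prime ideal is a regular local ring. *)

(* Defs.v *)
From HB Require Import structures.
From mathcomp Require Import all_boot all_order all_algebra.
From mathcomp Require Import mpoly.
Set Implicit Arguments. Unset Strict Implicit. Unset Printing Implicit Defensive.
Import Order.TTheory GRing.Theory Num.Theory.
Local Open Scope ring_scope.

(* Elementary commutative algebra for a subring A of a commutative     *)
(* ring R, A being given as a (Prop-valued) membership predicate.       *)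
Section SubringAlgebra.
Variable R : comRingType.
Variable A : R -> Prop.

Definition ideal_of (I : R -> Prop) : Prop :=
  [/\ (forall x, I x -> A x), I 0,
      (forall x y, I x -> I y -> I (x + y)) &
      (forall a x, A a -> I x -> I (a * x))].

Definition proper_ideal (I : R -> Prop) : Prop :=
  ideal_of I /\ exists x, A x /\ ~ I x.

Definition prime_ideal (I : R -> Prop) : Prop :=
  proper_ideal I /\
  forall a b, A a -> A b -> I (a * b) -> I a \/ I b.

Definition maximal_ideal (I : R -> Prop) : Prop :=
  proper_ideal I /\
  forall J, proper_ideal J -> (forall x, I x -> J x) -> forall x, J x <-> I x.

Definition ideal_generated_by (I : R -> Prop) (n : nat) (g : 'I_n -> R) : Prop :=
  (forall i, A (g i)) /\
  forall x, I x <-> exists c : 'I_n -> R, (forall i, A (c i)) /\ x = \sum_i c i * g i.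

Definition finitely_generated (I : R -> Prop) : Prop :=
  exists n (g : 'I_n -> R), ideal_generated_by I g.

Definition noetherian : Prop :=
  forall I, ideal_of I -> finitely_generated I.

Definition prime_chain (d : nat) (c : nat -> R -> Prop) : Prop :=
  (forall i, (i <= d)%N -> prime_ideal (c i)) /\
  (forall i, (i < d)%N ->
     (forall x, c i x -> c i.+1 x) /\ exists x, c i.+1 x /\ ~ c i x).

Definition krull_dim (d : nat) : Prop :=
  (exists c, prime_chain d c) /\ (forall e c, prime_chain e c -> (e <= d)%N).

Definition min_num_generators (I : R -> Prop) (n : nat) : Prop :=
  (exists g : 'I_n -> R, ideal_generated_by I g) /\
  (forall k (g : 'I_k -> R), ideal_generated_by I g -> (n <= k)%N).

Definition local_with (m : R -> Prop) : Prop :=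
  maximal_ideal m /\
  forall m', maximal_ideal m' -> forall x, m' x <-> m x.

Definition regular_local_ring : Prop :=
  noetherian /\
  exists m, local_with m /\ exists d, krull_dim d /\ min_num_generators m d.

End SubringAlgebra.

(* Localization of a subring S of an integral domain R at a prime ideal p
   of S, realized (canonically, since S is a domain) as the subring
   { a / s | a, s in S, s not in p } of the fraction field of R. *)
Definition localization (R : idomainType) (S : R -> Prop) (p : R -> Prop)
  : {fraction R} -> Prop :=
  fun z => exists a s, [/\ S a, S s, ~ p s & z = tofrac a / tofrac s].

Definition regular_ring (R : idomainType) (S : R -> Prop) : Prop :=
  noetherian S /\
  forall p, prime_ideal S p -> regular_local_ring (localization S p).

(* Two-variable polynomials: x = 'X_X0, y = 'X_X1 in {mpoly K[2]}.      *)
Definition X0 : 'I_2 := @Ordinal 2 0 isT.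
Definition X1 : 'I_2 := @Ordinal 2 1 isT.

Definition jac2 (K : comRingType) (P Q : {mpoly K[2]}) : {mpoly K[2]} :=
  mderiv X0 P * mderiv X1 Q - mderiv X1 P * mderiv X0 Q.

Definition endo2 (K : comRingType) (P Q : {mpoly K[2]}) :
  {mpoly K[2]} -> {mpoly K[2]} :=
  fun h => h \mPo [tuple P; Q].

Definition subalg_PQxy (K : comRingType) (P Q : {mpoly K[2]}) :
  {mpoly K[2]} -> Prop :=
  fun z => exists g : {mpoly K[3]}, z = g \mPo [tuple P; Q; 'X_X0 + 'X_X1].

(* Main.v *)
Require Import Defs.
From HB Require Import structures.
From mathcomp Require Import all_boot all_order all_algebra.
From mathcomp Require Import mpoly ring zify.
From Stdlib Require Import Classical.
Set Implicit Arguments.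
Unset Strict Implicit.
Unset Printing Implicit Defensive.
Import GRing.Theory.
Local Open Scope ring_scope.

(** Let [F : K^n -> K^n] be a polynomial map with invertible Jacobian matrix and
    let [z] be a polynomial.  Since [K[T_1, ..., T_n, T]] is factorial and the
    components of [F] are algebraically independent, the relations between [F]
    and [z] are the multiples of a single prime [h].  Differentiating
    [h(F, z) = 0] and inverting the Jacobian shows that the whole gradient of
    [h] vanishes wherever [g = h_T(F, z)] does.  If [K[F, z]] is nonsingular at
    every point coming from [K^n], then [g] has no zero, so it is a nonzero
    constant [e]; now [h] divides [h_T - e], hence [h_T = e] for degree reasons,
    [h] is linear in [T], and [z] lies in [K[F]].
    Regularity gives nonsingularity for [z = x + y]: at a singular point the
    local ring has embedding dimension 3 but Krull dimension at most 2.  Once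
    [x + y] is in [K[P, Q]], the ring [K[P, Q, x]] is [K[x, y]], which is
    nonsingular, so the same argument with [z = x] puts [x], and then [y], in
    [K[P, Q]]. *)

(** * Factorial rings and Gauss's lemma *)

Section Divisibility.
Variable R : idomainType.
Implicit Types a b c p u : R.

Definition divides a b := exists c, b = c * a.

Definition prime_elt p :=
  [/\ p != 0, p \isn't a GRing.unit &
      forall a b, divides p (a * b) -> divides p a \/ divides p b].

Inductive prime_factored : R -> Prop :=
| prime_factored_unit u of u \is a GRing.unit : prime_factored u
| prime_factored_mulp p a of prime_elt p & prime_factored a :
    prime_factored (p * a).

Definition factorial_ring := forall a, a != 0 -> prime_factored a.

Lemma divides_mull a b c : divides a b -> divides a (c * b).
Proof. by case=> d ->; exists (c * d); rewrite mulrA. Qed.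

Lemma divides_mulr a b c : divides a b -> divides a (b * c).
Proof. by rewrite mulrC; apply: divides_mull. Qed.

Lemma prime_factored_prime p : prime_elt p -> prime_factored p.
Proof.
move=> pP; rewrite -[p]mulr1; apply: prime_factored_mulp => //.
by apply: prime_factored_unit; rewrite unitr1.
Qed.

Lemma prime_factored_mul a b :
  prime_factored a -> prime_factored b -> prime_factored (a * b).
Proof.
move=> aP bP; elim: aP => [u uu|p c pP _ IH]; last first.
  by rewrite -mulrA; apply: prime_factored_mulp.
elim: bP => [v uv|p c pP _ IH].
  by apply: prime_factored_unit; rewrite unitrM uu.
by rewrite mulrCA; apply: prime_factored_mulp.
Qed.

Lemma prime_factored_unit_or_prime a : prime_factored a ->
  a \is a GRing.unit \/ exists2 p, prime_elt p & divides p a.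
Proof.
case=> [u uu|p b pP _]; first by left.
by right; exists p => //; exists b; rewrite mulrC.
Qed.

End Divisibility.

Section FactorialTransfer.
Variables (R S : idomainType) (f : {rmorphism R -> S}) (g : S -> R).
Hypotheses (fK : cancel f g) (gK : cancel g f).

Lemma divides_iso a b : divides (f a) (f b) <-> divides a b.
Proof.
split=> [[c e]|[c ->]]; last by exists (f c); rewrite rmorphM.
by exists (g c); apply: (can_inj fK); rewrite rmorphM gK.
Qed.

Lemma unit_iso a : (f a \is a GRing.unit) = (a \is a GRing.unit).
Proof.
apply/idP/idP => [/unitrPr[b fab]|]; last exact: rmorph_unit.
apply/unitrPr; exists (g b); apply: (can_inj fK).
by rewrite rmorphM gK fab rmorph1.
Qed.

Lemma prime_elt_iso p : prime_elt (f p) <-> prime_elt p.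
Proof.
have f0 a : (f a == 0) = (a == 0) by rewrite -(inj_eq (can_inj fK)) rmorph0.
split=> -[pn0 pnu pP].
  split; rewrite -?f0 -?unit_iso // => a b /divides_iso.
  by rewrite rmorphM => /pP[]/divides_iso; [left | right].
split; rewrite ?f0 ?unit_iso // => a b.
rewrite -(gK a) -(gK b) -rmorphM => /divides_iso/pP[].
  by left; apply/divides_iso.
by right; apply/divides_iso.
Qed.

Lemma factorial_iso : factorial_ring S -> factorial_ring R.
Proof.
move=> facS a an0; have : prime_factored (f a).
  by apply: facS; rewrite -(rmorph0 f) (inj_eq (can_inj fK)).
rewrite -{2}(fK a); elim: (f a) / => [u uu|p b pP _ IH].
  by apply: prime_factored_unit; rewrite -unit_iso gK.
have -> : g (p * b) = g p * g b.
  by apply: (can_inj fK); rewrite rmorphM !gK.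
by apply: prime_factored_mulp => //; apply/prime_elt_iso; rewrite gK.
Qed.

End FactorialTransfer.

Lemma prime_factored_rmorph_eq0 (R S : idomainType) (f : {rmorphism R -> S}) a :
  prime_factored a -> f a = 0 -> exists2 p, prime_elt p & f p = 0.
Proof.
elim=> [u uu fu0|p b pP _ IH].
  by have := rmorph_unit f uu; rewrite fu0 unitr0.
rewrite rmorphM => /eqP; rewrite mulf_eq0 => /orP[/eqP fp0|/eqP/IH //].
by exists p.
Qed.

(* Below [%|], [coprimep] and [irreducible_poly] refer to divisibility over the
   fraction field of [R], whereas [divides] is divisibility in [{poly R}]. *)
Section PolyDivisibility.
Variable R : idomainType.
Implicit Types (a c l p : R) (d f g h : {poly R}).
Import Pdiv.Idomain.

Lemma divides_dvdp d f : divides d f -> d %| f.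
Proof. by case=> q ->; apply: dvdp_mull. Qed.

Lemma divides_polyC_MXaddC p f a : divides p%:P (f * 'X + a%:P) ->
  divides p%:P f /\ divides p a.
Proof.
case=> q /polyP e; split; last first.
  by exists q`_0; have := e 0; rewrite coefD coefMX coefC coefMC add0r.
exists (drop_poly 1 q); apply/polyP => i; have := e i.+1.
by rewrite coefD coefMX coefC !coefMC coef_drop_poly addn1 addr0.
Qed.

Lemma prime_polyC p : prime_elt p -> prime_elt p%:P.
Proof.
case=> pn0 pnu pP; split; rewrite ?polyC_eq0 //.
  by apply: contra pnu; rewrite poly_unitE coefC => /andP[].
have divMXaddC f a :
    divides p%:P f -> divides p a -> divides p%:P (f * 'X + a%:P).
  by case=> k -> [e ->]; exists (k * 'X + e%:P); rewrite polyCM; ring.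
elim/poly_ind=> [|f a IHf] g; first by left; exists 0; rewrite mul0r.
elim/poly_ind: g => [|g b IHg]; first by right; exists 0; rewrite mul0r.
have -> : (f * 'X + a%:P) * (g * 'X + b%:P) =
    (f * (g * 'X + b%:P) + a%:P * g) * 'X + (a * b)%:P by rewrite polyCM; ring.
case/divides_polyC_MXaddC=> [[q qE]] /pP[pa|pb].
- have : divides p%:P (f * (g * 'X + b%:P)).
    case: pa qE => k -> qE; exists (q - k%:P * g).
    by rewrite mulrBl -qE polyCM; ring.
  by case/IHf; [left; apply: divMXaddC | right].
- have : divides p%:P ((f * 'X + a%:P) * g).
    case: pb qE => k -> qE; exists (q - f * k%:P).
    by rewrite mulrBl -qE polyCM; ring.
  by case/IHg; [left | right; apply: divMXaddC].
Qed.

Lemma irreducible_coprimep_or_dvdp f g :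
  irreducible_poly f -> coprimep f g \/ f %| g.
Proof.
case=> _ irr; have [|/irr gcdf] := boolP (coprimep f g); first by left.
by right; rewrite -(eqp_dvdl _ (gcdf (dvdp_gcdl f g))) dvdp_gcdr.
Qed.

Lemma prime_elt_dvdp h g :
  prime_elt h -> (1 < size h)%N -> h %| g -> divides h g.
Proof.
case=> _ _ hP sh /dvdpP[[c q] /= cn0 e].
have [hc|//] : divides h c%:P \/ divides h g.
  by apply: hP; exists q; rewrite mul_polyC.
have := dvdp_leq _ (divides_dvdp hc); rewrite size_polyC cn0 polyC_eq0.
by move=> /(_ cn0); rewrite leqNgt sh.
Qed.

Lemma prime_elt_irreducible h :
  prime_elt h -> (1 < size h)%N -> irreducible_poly h.
Proof.
move=> hP sh; have [hn0 _ hprime] := hP; split=> // q sq qh.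
have [[c r] /= cn0 e] := dvdpP _ _ qh.
have [[k er]|hq] : divides h r \/ divides h q.
- by apply: hprime; exists c%:P; rewrite mul_polyC.
- have /eqP : size (k * q) = 1%N.
    have -> : k * q = c%:P.
      by apply: (mulIf hn0); rewrite mul_polyC e er mulrAC.
    by rewrite size_polyC cn0.
  by rewrite size_mul_eq1 => /andP[_]; rewrite (negPf sq).
- by rewrite /eqp qh divides_dvdp.
Qed.

Lemma prime_elt_bezout h g : prime_elt h -> ~ divides h g ->
  exists c u v, c != 0 /\ c%:P = u * h + v * g.
Proof.
move=> hP ndvd; case: (leqP (size h) 1) => [/size1_polyC eh|sh].
  exists h`_0, 1, 0; rewrite -eh mul1r mul0r addr0; split=> //.
  by rewrite -polyC_eq0 -eh; case: hP.
have [cop|/(prime_elt_dvdp hP sh)//] :=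
  irreducible_coprimep_or_dvdp g (prime_elt_irreducible hP sh).
have [[u v] /eqpP[[c1 c2] /= /andP[_ c2n0] e]] := Bezout_coprimepP _ _ cop.
exists c2, (c1 *: u), (c1 *: v); split=> //.
by rewrite -!scalerAl -scalerDr e alg_polyC.
Qed.

Definition primitive_poly f := forall p, prime_elt p -> ~ divides p%:P f.

Lemma primitive_polyMl f g : primitive_poly (f * g) -> primitive_poly f.
Proof. by move=> fg p pP pf; apply: (fg p pP); apply: divides_mulr. Qed.

Lemma primitive_polyMr f g : primitive_poly (f * g) -> primitive_poly g.
Proof. by rewrite mulrC; apply: primitive_polyMl. Qed.

Lemma primitive_part l f :
    prime_factored l -> (forall c, divides c%:P f -> divides c l) ->
  exists c g, [/\ prime_factored c, f = c *: g & primitive_poly g].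
Proof.
move=> lP; elim: lP f => [u uu|p a pP _ IH] f cont.
  exists 1, f; split; [exact/prime_factored_unit/unitr1 | by rewrite scale1r |].
  move=> p [_ pnu _] /cont[k eu]; move: uu.
  by rewrite eu unitrM (negPf pnu) andbF.
have [pn0 _ pprime] := pP; have pI := mulfI pn0.
have [[k ek]|ndvd] := classic (divides p%:P f).
  have [c [q kE]|c [g [cP kE gP]]] := IH k.
    have [|e he] := cont (p * c); first by exists q; rewrite ek kE polyCM; ring.
    by exists e; apply: pI; rewrite he mulrCA.
  exists (p * c), g; split=> //; first exact: prime_factored_mulp.
  by rewrite ek kE mulrC mul_polyC scalerA.
apply: IH => c cf; have [e he] := cont c cf.
have [[k hk]|[k hk]] : divides p e \/ divides p c.
- by apply: pprime; exists a; rewrite -he mulrC.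
- by exists k; apply: pI; rewrite he hk mulrAC mulrC.
case: ndvd; case: cf => g ->; exists (g * k%:P).
by rewrite hk polyCM mulrA.
Qed.

End PolyDivisibility.

Section FactorialPoly.
Variable R : idomainType.
Hypothesis facR : factorial_ring R.
Implicit Types (c : R) (d f g q r : {poly R}).
Import Pdiv.Idomain.

Lemma scale_eq_mul_split c f d r : c != 0 -> c *: f = d * r ->
  exists c1 c2 d' r',
    [/\ c = c1 * c2, d = c1 *: d', r = c2 *: r' & f = d' * r'].
Proof.
move=> /facR cP; elim: cP d r => [u uu|p a pP _ IH] d r e.
  exists u, 1, (u^-1 *: d), r; rewrite mulr1 scale1r scalerA divrr // scale1r.
  by split=> //; rewrite -scalerAl -e scalerA mulVr // scale1r.
have [pn0 _ pprime] := prime_polyC pP.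
have pI := mulfI pn0; move: e; rewrite -scalerA -mul_polyC => e.
have : divides p%:P (d * r) by rewrite -e; exists (a *: f); rewrite mulrC.
case/pprime=> -[k ek]; rewrite ek in e *; move: e => {ek}.
  rewrite [k * _]mulrC -mulrA => /pI/IH[c1 [c2 [d' [r' [-> -> -> ->]]]]].
  by exists (p * c1), c2, d', r'; rewrite mul_polyC scalerA mulrA.
rewrite mulrA [_ * p%:P]mulrC => /pI/IH[c1 [c2 [d' [r' [-> -> -> ->]]]]].
exists c1, (p * c2), d', r'.
by rewrite [_ * p%:P]mulrC mul_polyC scalerA mulrCA.
Qed.

Lemma primitive_scale_unit c f :
  c != 0 -> primitive_poly (c *: f) -> c \is a GRing.unit.
Proof.
move=> /facR/prime_factored_unit_or_prime[//|[p pP [k ->]]] /(_ p pP)[].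
by exists (k *: f); rewrite -!mul_polyC polyCM mulrAC.
Qed.

Lemma primitive_dvdp d f : primitive_poly d -> d %| f -> divides d f.
Proof.
move=> dP /dvdpP[[c q] /= cn0 /(scale_eq_mul_split cn0)].
case=> c1 [c2 [q' [d' [cE _ dE ->]]]].
have c2n0 : c2 != 0 by apply: contraNneq cn0 => c20; rewrite cE c20 mulr0.
have uc2 : c2 \is a GRing.unit.
  by apply: (@primitive_scale_unit c2 d'); rewrite -?dE.
exists (c2^-1 *: q').
by rewrite dE -scalerAr -scalerAl scalerA divrr ?scale1r.
Qed.

Lemma primitive_irreducible_prime f :
  primitive_poly f -> irreducible_poly f -> prime_elt f.
Proof.
move=> fP irr; have [sf _] := irr.
split; first exact: irredp_neq0.
  by apply: contraL sf; rewrite poly_unitE => /andP[/eqP->].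
move=> a b /divides_dvdp fab.
have [cop|fa] := irreducible_coprimep_or_dvdp a irr; last first.
  by left; apply: primitive_dvdp.
by right; apply: primitive_dvdp => //; rewrite -(Gauss_dvdpr _ cop).
Qed.

Lemma reducible_poly_factor f : (1 < size f)%N -> ~ irreducible_poly f ->
  exists a b : {poly R},
    [/\ f = a * b, (size a < size f)%N & (size b < size f)%N].
Proof.
move=> sf red; have fn0 : f != 0 by rewrite -size_poly_gt0 ltnW.
have [q [sq qf nqf]] : exists q, [/\ size q != 1%N, q %| f & ~~ (q %= f)].
  apply: NNPP => none; apply: red; split=> // q sq qf.
  by apply/negPn/negP => nqf; apply: none; exists q.
have [[c r] /= cn0 e] := dvdpP _ _ qf.
have [c1 [c2 [r' [q' [cE _ qE fE]]]]] := scale_eq_mul_split cn0 e.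
have sqf : (size q < size f)%N.
  by rewrite ltn_neqAle dvdp_size_eqp // nqf dvdp_leq.
have sq' : size q' = size q.
  rewrite qE size_scale //.
  by apply: contraNneq cn0 => c20; rewrite cE c20 mulr0.
have [rn0 qn0] : r' != 0 /\ q' != 0.
  by apply/andP; rewrite -negb_or -mulf_eq0 -fE.
exists r', q'; split; rewrite ?sq' //.
rewrite fE size_mul //; move: rn0 qn0 sq; rewrite -sq' -!size_poly_gt0.
by move: (size r') (size q') => m n; lia.
Qed.

Lemma primitive_poly_factored f :
  f != 0 -> primitive_poly f -> prime_factored f.
Proof.
have [n] := ubnP (size f); elim: n f => // n IH f lt fn0 fP.
case: (leqP (size f) 1) => [/size1_polyC ef|sf].
  apply: prime_factored_unit; rewrite ef; apply: rmorph_unit.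
  apply: (@primitive_scale_unit _ 1); first by rewrite -polyC_eq0 -ef.
  by rewrite alg_polyC -ef.
have [irr|/(reducible_poly_factor sf)[a [b [ef sa sb]]]] :=
    classic (irreducible_poly f).
  exact/prime_factored_prime/primitive_irreducible_prime.
have [an0 bn0] : a != 0 /\ b != 0 by apply/andP; rewrite -negb_or -mulf_eq0 -ef.
rewrite ef in fP *; apply: prime_factored_mul; apply: IH => //.
- by apply: leq_trans sa _; rewrite -ltnS.
- exact: primitive_polyMl fP.
- by apply: leq_trans sb _; rewrite -ltnS.
- exact: primitive_polyMr fP.
Qed.

Lemma factorial_poly : factorial_ring {poly R}.
Proof.
move=> f fn0.
have [||c [g [cP ef gP]]] := primitive_part (l := lead_coef f) (f := f).
- by apply: facR; rewrite lead_coef_eq0.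
- by move=> c [k ->]; exists (lead_coef k); rewrite lead_coefM lead_coefC.
have gn0 : g != 0 by apply: contraNneq fn0 => g0; rewrite ef g0 scaler0.
rewrite ef -mul_polyC; apply: prime_factored_mul; last first.
  exact: primitive_poly_factored.
elim: cP => [u uu|p a pP _ IH]; first exact/prime_factored_unit/rmorph_unit.
by rewrite polyCM; apply: prime_factored_mulp => //; apply: prime_polyC.
Qed.

End FactorialPoly.

(** * Multivariate polynomials *)

Lemma mpoly0_polyC (R : nzRingType) (p : {mpoly R[0]}) : p = (p@_0)%:MP.
Proof.
apply: msize1_polyC; rewrite msizeE; apply/bigmax_leqP_seq => m _ _.
by rewrite mdegE big_ord0.
Qed.

Lemma mpolyC_neq0_unit (K : fieldType) n (c : K) :
  c != 0 -> c%:MP_[n] \is a GRing.unit.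
Proof. by move=> cn0; apply: rmorph_unit; rewrite unitfE. Qed.

Section MPolyMorphisms.
Variables (n : nat) (R : comNzRingType).

Lemma mpoly_ring_ind (T : {mpoly R[n]} -> Prop) :
    (forall c, T c%:MP) -> (forall i, T 'X_i) ->
    (forall p q, T p -> T q -> T (p + q)) ->
    (forall p q, T p -> T q -> T (p * q)) ->
  forall p, T p.
Proof.
move=> TC TX TD TM; elim/mpolyind=> [|c m p _ _ Tp]; first by rewrite -mpolyC0.
apply: TD => //; rewrite -mul_mpolyC; apply: (TM) => //.
rewrite mpolyXE_id; apply: (big_ind T) => [|a b|i _].
- by rewrite -mpolyC1.
- exact: TM.
by elim: (m i) => [|k IH]; rewrite ?expr0 -?mpolyC1 // exprS; apply: TM.
Qed.

Lemma mpoly_rmorph_eq (S : nzRingType) (f g : {rmorphism {mpoly R[n]} -> S}) :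
    (forall c, f c%:MP = g c%:MP) -> (forall i, f 'X_i = g 'X_i) -> f =1 g.
Proof.
move=> fgC fgX; apply: mpoly_ring_ind => // p q fgp fgq.
  by rewrite !rmorphD fgp fgq.
by rewrite !rmorphM fgp fgq.
Qed.

Lemma comp_mpolyX_tnth k (lq : n.-tuple {mpoly R[k]}) i :
  'X_i \mPo lq = tnth lq i.
Proof. by rewrite comp_mpolyXU -tnth_nth. Qed.

Lemma comp_mpolyM k (lq : n.-tuple {mpoly R[k]}) :
  {morph comp_mpoly lq : p q / p * q}.
Proof. exact: rmorphM. Qed.

Lemma comp_mpolyA k l (lq : n.-tuple {mpoly R[k]}) (lr : k.-tuple {mpoly R[l]})
    (p : {mpoly R[n]}) :
  (p \mPo lq) \mPo lr = p \mPo [tuple tnth lq i \mPo lr | i < n].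
Proof.
apply: (@mpoly_rmorph_eq _ (comp_mpoly lr \o comp_mpoly lq) (comp_mpoly _))
  => [c|i] /=.
  by rewrite !comp_mpolyC.
by rewrite !comp_mpolyX_tnth tnth_mktuple.
Qed.

Lemma mderivXU (i j : 'I_n) : ('X_i : {mpoly R[n]})^`M(j) = (i == j)%:R.
Proof.
rewrite mderivX mnm1E; case: eqP => [->|_]; last by rewrite scale0r.
by rewrite scale1r -[X in (X - _)%MM]add0m addmK mpolyX0.
Qed.

Lemma mderiv_comp_mpoly k (lq : n.-tuple {mpoly R[k]}) (p : {mpoly R[n]}) i :
  (p \mPo lq)^`M(i) = \sum_(j < n) (p^`M(j) \mPo lq) * (tnth lq j)^`M(i).
Proof.
elim/mpoly_ring_ind: p => [c|j|p q Dp Dq|p q Dp Dq].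
- rewrite comp_mpolyC mderivC big1 // => j _.
  by rewrite mderivC comp_mpoly0 mul0r.
- rewrite comp_mpolyX_tnth (bigD1 j) //= big1 ?addr0.
    by rewrite mderivXU eqxx comp_mpoly1 mul1r.
  by move=> l lj; rewrite mderivXU eq_sym (negPf lj) comp_mpoly0 mul0r.
- rewrite comp_mpolyD mderivD Dp Dq -big_split; apply: eq_bigr => j _ /=.
  by rewrite mderivD comp_mpolyD mulrDl.
- rewrite comp_mpolyM mderivM Dp Dq mulr_suml mulr_sumr -big_split.
  apply: eq_bigr => j _ /=.
  by rewrite mderivM comp_mpolyD !comp_mpolyM; ring.
Qed.

End MPolyMorphisms.

Section MPolyLastVariable.
Variables (n : nat) (R : comNzRingType).
Implicit Types (p : {mpoly R[n]}) (g : {mpoly R[n.+1]}).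
Implicit Types f : {poly {mpoly R[n]}}.
Local Notation widen := (widen_ord (leqnSn n)).

Lemma ord_max_or_widen (i : 'I_n.+1) : i = ord_max \/ exists j, i = widen j.
Proof.
case: (ltnP i n) => [lt|ge]; last first.
  by left; apply: val_inj => /=; apply/eqP; rewrite eqn_leq ge -ltnS ltn_ord.
by right; exists (Ordinal lt); apply: val_inj.
Qed.

Lemma ord_max_eq_widenF (i : 'I_n) : (ord_max == widen i) = false.
Proof. by rewrite -val_eqE /= gtn_eqF. Qed.

Lemma muniXm (m : 'X_{1..n.+1}) : muni ('X_[m] : {mpoly R[n.+1]}) =
  'X_[[multinom m (widen i) | i < n]] *: 'X^(m ord_max).
Proof. by rewrite muniE msuppX big_seq1 mcoeffX eqxx scale1r. Qed.

Lemma muniX_max : muni ('X_ord_max : {mpoly R[n.+1]}) = 'X.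
Proof.
rewrite muniXm mnm1E eqxx expr1; set m := [multinom _ | _ < _].
suff -> : m = 0%MM by rewrite mpolyX0 scale1r.
by apply/mnmP=> i; rewrite mnmE mnm1E mnm0E ord_max_eq_widenF.
Qed.

Lemma muniX_widen i : muni ('X_(widen i) : {mpoly R[n.+1]}) = ('X_i)%:P.
Proof.
rewrite muniXm mnm1E [widen i == _]eq_sym ord_max_eq_widenF expr0 alg_polyC.
by congr ('X_[_])%:P; apply/mnmP=> j; rewrite mnmE !mnm1E -!val_eqE.
Qed.

Lemma mwidenX_widen (i : 'I_n) : mwiden ('X_i : {mpoly R[n]}) = 'X_(widen i).
Proof. by rewrite mwidenX mnmwiden1. Qed.

Lemma muni_mwiden p : muni (mwiden p) = p%:P.
Proof.
apply: (@mpoly_rmorph_eq _ _ _ (@muni n R \o @mwiden n R) polyC) => [c|i] /=.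
  by rewrite mwidenC muniC.
by rewrite mwidenX_widen muniX_widen.
Qed.

Lemma mmultiE f : mmulti f = (map_poly (@mwiden n R) f).['X_ord_max].
Proof.
rewrite (horner_coef_wide _ (size_poly _ _)) /mmulti; apply: eq_bigr => i _.
by rewrite coef_map.
Qed.

Lemma muniK : cancel (@muni n R) (@mmulti n R).
Proof.
move=> g; rewrite mmultiE.
apply: (@mpoly_rmorph_eq _ _ _
  (horner_eval 'X_ord_max \o map_poly (@mwiden n R) \o @muni n R) idfun)
  => [c|i] /=.
  by rewrite muniC map_polyC /horner_eval hornerC /= mwidenC.
case: (ord_max_or_widen i) => [->|[j ->]].
  by rewrite muniX_max map_polyX /horner_eval hornerX.
by rewrite muniX_widen map_polyC /horner_eval hornerC /= mwidenX_widen.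
Qed.

Lemma mmultiK : cancel (@mmulti n R) (@muni n R).
Proof.
move=> f; rewrite /mmulti raddf_sum /= -[RHS]coefK poly_def.
apply: eq_bigr => i _.
by rewrite muniM muni_mwiden rmorphXn /= muniX_max mul_polyC.
Qed.

Lemma muni_eq0 g : (muni g == 0) = (g == 0).
Proof. by rewrite -(inj_eq (can_inj muniK)) muni0. Qed.

Lemma mmap_muni (S : comNzRingType) (f : {rmorphism R -> S})
    (h : 'I_n.+1 -> S) g :
  mmap f h g =
    (map_poly (mmap f (fun i => h (widen i))) (muni g)).[h ord_max].
Proof.
apply: (@mpoly_rmorph_eq _ _ _ (mmap f h) (horner_eval (h ord_max)
  \o map_poly (mmap f (fun i => h (widen i))) \o @muni n R)) => [c|i] /=.
  by rewrite mmapC muniC map_polyC /= mmapC /horner_eval hornerC.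
rewrite mmapX mmap1U; case: (ord_max_or_widen i) => [->|[j ->]].
  by rewrite muniX_max map_polyX /horner_eval hornerX.
by rewrite muniX_widen map_polyC /= mmapX mmap1U /horner_eval hornerC.
Qed.

Lemma tnth_rcons_max (T : Type) (s : n.-tuple T) x :
  tnth [tuple of rcons s x] ord_max = x.
Proof. by rewrite (tnth_nth x) nth_rcons size_tuple ltnn eqxx. Qed.

Lemma tnth_rcons_widen (T : Type) (s : n.-tuple T) x i :
  tnth [tuple of rcons s x] (widen i) = tnth s i.
Proof. by rewrite !(tnth_nth x) nth_rcons size_tuple /= ltn_ord. Qed.

Lemma mwiden_comp_rcons k (lq : n.-tuple {mpoly R[k]}) z p :
  mwiden p \mPo [tuple of rcons lq z] = p \mPo lq.
Proof.
apply: (@mpoly_rmorph_eq _ _ _ (comp_mpoly [tuple of rcons lq z] \o @mwiden n R)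
  (comp_mpoly lq)) => [c|i] /=.
  by rewrite mwidenC !comp_mpolyC.
by rewrite mwidenX_widen !comp_mpolyX_tnth tnth_rcons_widen.
Qed.

End MPolyLastVariable.

Lemma msize_mderiv_lt (R : nzRingType) n (p : {mpoly R[n]}) i :
  p != 0 -> (msize p^`M(i) < msize p)%N.
Proof.
move=> pn0; rewrite [X in (_ < X)%N]mpolySpred // ltnS msizeE.
apply/bigmax_leqP_seq => m; rewrite mcoeff_msupp mcoeff_mderiv => mp _.
have : (m + U_(i))%MM \in msupp p.
  by rewrite mcoeff_msupp; apply: contraNneq mp => ->; rewrite mul0rn.
by move/msize_mdeg_lt; rewrite mdegD mdeg1; lia.
Qed.

Section MPolySize.
Variable R : idomainType.

Lemma msize_mul_leq n (p q : {mpoly R[n]}) a b :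
  (msize p <= a.+1)%N -> (msize q <= b.+1)%N -> (msize (p * q) <= (a + b).+1)%N.
Proof.
have [->|pn0] := eqVneq p 0; first by rewrite mul0r msize0.
have [->|qn0] := eqVneq q 0; first by rewrite mulr0 msize0.
by rewrite msizeM //; move: (msize p) (msize q) => x y; lia.
Qed.

Lemma msize_comp_mpolyX n k (lq : n.-tuple {mpoly R[k]}) d m :
    (forall i, msize (tnth lq i) <= d.+1)%N ->
  (msize ('X_[m] \mPo lq) <= (mdeg m * d).+1)%N.
Proof.
move=> sq; rewrite comp_mpolyX mdegE big_distrl /=.
elim/big_rec2: _ => [|i q a _ IH]; first by rewrite msize1.
apply: msize_mul_leq => //; elim: (m i) => [|e IHe].
  by rewrite expr0 msize1.
by rewrite exprS mulSn; apply: msize_mul_leq.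
Qed.

Lemma divides_msize_leq n (p q : {mpoly R[n]}) :
  q != 0 -> divides p q -> (msize p <= msize q)%N.
Proof.
move=> qn0 [k qE]; move: qn0; rewrite qE mulf_eq0 => /norP[kn0 pn0].
rewrite msizeM //; move: kn0; rewrite -msize_poly_eq0.
by move: (msize k) (msize p) => a b; lia.
Qed.

End MPolySize.

Section MPolyCharZero.
Variable R : idomainType.
Hypothesis charR0 : [pchar R] =i pred0.

Lemma mderiv_eq0_msupp n (p : {mpoly R[n]}) i m :
  p^`M(i) = 0 -> m \in msupp p -> m i = 0%N.
Proof.
move=> dp; rewrite mcoeff_msupp => mp; apply/eqP; rewrite -leqn0 leqNgt.
apply/negP => mi; have lem : (U_(i) <= m)%MM by rewrite lep1mP -lt0n.
have /mpolyP/(_ (m - U_(i))%MM) := dp; rewrite mcoeff_mderiv submK // mcoeff0.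
move/eqP; rewrite -mulr_natr mulf_eq0 (negPf mp) /=.
by rewrite ((pcharf0P _).1 charR0).
Qed.

Lemma mderiv_eq0_polyC n (p : {mpoly R[n]}) :
  (forall i, p^`M(i) = 0) -> p = (p@_0)%:MP.
Proof.
move=> dp; apply: msize1_polyC; rewrite msizeE.
apply/bigmax_leqP_seq => m mp _; rewrite mdegE big1 // => i _.
exact: mderiv_eq0_msupp (dp i) mp.
Qed.

Lemma mderiv_max_eq0_mwiden n (p : {mpoly R[n.+1]}) :
  p^`M(ord_max) = 0 -> exists w : {mpoly R[n]}, p = mwiden w.
Proof.
move=> dp; exists (muni p)`_0; rewrite -[LHS]muniK -[mwiden _]muniK muni_mwiden.
congr mmulti; rewrite muniE coef_sum rmorph_sum; apply: eq_big_seq => m mp /=.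
by rewrite (mderiv_eq0_msupp dp mp) expr0 alg_polyC coefC /=.
Qed.

Lemma mderiv_max_const n (h : {mpoly R[n.+1]}) e : h^`M(ord_max) = e%:MP ->
  exists w : {mpoly R[n]}, h = e *: 'X_ord_max + mwiden w.
Proof.
move=> dh; have [|w hw] := @mderiv_max_eq0_mwiden n (h - e *: 'X_ord_max).
  by rewrite mderivB dh mderivZ mderivXU eqxx alg_mpolyC subrr.
by exists w; rewrite -hw addrC subrK.
Qed.

End MPolyCharZero.

Section FieldMPoly.
Variable K : fieldType.

Lemma factorial_mpoly n : factorial_ring {mpoly K[n]}.
Proof.
elim: n => [|n IH].
  move=> a; rewrite (mpoly0_polyC a) mpolyC_eq0 => an0.
  exact/prime_factored_unit/mpolyC_neq0_unit.
exact: (factorial_iso (@muniK n K) (@mmultiK n K) (factorial_poly IH)).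
Qed.

Lemma prime_elt_mpoly_bezout n (h g : {mpoly K[n.+1]}) :
    prime_elt h -> ~ divides h g ->
  exists c u v, c != 0 /\ mwiden c = u * h + v * g.
Proof.
move=> /(prime_elt_iso (@muniK n K) (@mmultiK n K)) hP ndvd.
have [|c [u [v [cn0 ec]]]] := @prime_elt_bezout _ _ (muni g) hP.
  by move/(divides_iso (@muniK n K) (@mmultiK n K)).
exists c, (mmulti u), (mmulti v); split=> //; apply: (can_inj (@muniK n K)).
by rewrite muni_mwiden ec muniD !muniM !mmultiK.
Qed.

Lemma rmorph_kernel_principal n (S : idomainType)
    (f : {rmorphism {mpoly K[n.+1]} -> S}) G :
    (forall w : {mpoly K[n]}, f (mwiden w) = 0 -> w = 0) ->
    G != 0 -> f G = 0 ->
  exists2 h, prime_elt h & forall H, f H = 0 <-> divides h H.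
Proof.
move=> f_inj Gn0 fG0.
have [h hP fh0] := prime_factored_rmorph_eq0 (factorial_mpoly Gn0) fG0.
exists h => // H; split=> [fH0|[k ->]]; last by rewrite rmorphM fh0 mulr0.
apply: NNPP => /(prime_elt_mpoly_bezout hP)[d [u [v [dn0 ed]]]].
case/eqP: dn0; apply: f_inj.
by rewrite ed rmorphD !rmorphM fh0 fH0 !mulr0 addr0.
Qed.

Lemma nonunit_msize_gt1 n (p : {mpoly K[n]}) :
  p != 0 -> p \isn't a GRing.unit -> (1 < msize p)%N.
Proof.
move=> pn0; apply: contraNltn => /msize1_polyC ep; move: pn0.
by rewrite ep mpolyC_eq0; apply: mpolyC_neq0_unit.
Qed.

Lemma divides_mderivB_const n (h : {mpoly K[n]}) i e :
    h != 0 -> h \isn't a GRing.unit -> divides h (h^`M(i) - e%:MP) ->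
  h^`M(i) = e%:MP.
Proof.
move=> hn0 hnu hdvd; apply/eqP; rewrite -subr_eq0; apply/negPn/negP => dn0.
have := leq_trans (divides_msize_leq dn0 hdvd) (msizeD_le _ _).
rewrite msizeN msizeC leq_max leqNgt msize_mderiv_lt //= => le1.
by have := leq_trans (nonunit_msize_gt1 hn0 hnu) le1; case: (e != 0).
Qed.

End FieldMPoly.

Section ClosedFieldMPoly.
Variable K : closedFieldType.

Lemma mpoly_neq0_meval n (p : {mpoly K[n]}) : p != 0 -> exists v, p.@[v] != 0.
Proof.
elim: n p => [|n IH] p pn0.
  exists (fun => 0); apply: contraNneq pn0.
  by rewrite (mpoly0_polyC p) mevalC => ->; rewrite mpolyC0.
have /IH[w wn0] : lead_coef (muni p) != 0.
  by rewrite lead_coef_eq0 muni_eq0.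
have /closed_nonrootP[x nroot] : map_poly (meval w) (muni p) != 0.
  by rewrite -lead_coef_eq0 lead_coef_map_eq.
exists (fun i => if unlift ord_max i is Some j then w j else x).
rewrite /meval mmap_muni unlift_none; move: nroot; rewrite /root.
congr (_.[_] != 0); apply: eq_map_poly => q; apply: meval_eq => j.
have -> : widen_ord (leqnSn n) j = lift ord_max j.
  by apply: ord_inj; rewrite lift_max.
by rewrite liftK.
Qed.

Lemma mpoly_nonvanishing_const n (p : {mpoly K[n]}) :
  (forall v, p.@[v] != 0) -> exists2 c, c != 0 & p = c%:MP.
Proof.
move=> pn0; exists p.@[fun => 0]; first exact: pn0.
apply/eqP; rewrite -subr_eq0; apply/negPn/negP => /mpoly_neq0_meval[v].
rewrite mevalB mevalC subr_eq0 => /negP; apply; apply/eqP.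
pose l := mmap polyC (fun i => v i *: 'X) p.
have lE x : l.[x] = p.@[fun i => x * v i].
  apply: (@mpoly_rmorph_eq _ _ _
    (horner_eval x \o mmap polyC (fun i => v i *: 'X)) (meval _)) => [c|i] /=.
    by rewrite mmapC mevalC /horner_eval hornerC.
  by rewrite mmapX mmap1U mevalXU /horner_eval hornerZ hornerX mulrC.
have sl : size l = 1%N.
  apply/eqP/negPn/negP => /closed_rootP[x]; rewrite /root lE => /eqP e.
  by have := pn0 (fun i => x * v i); rewrite e eqxx.
have lC x : l.[x] = l`_0 by rewrite [l]size1_polyC ?sl // hornerC coefC.
have <- : l.[1] = p.@[v] by rewrite lE; apply: meval_eq => i; rewrite mul1r.
have <- : l.[0] = p.@[fun => 0].
  by rewrite lE; apply: meval_eq => i; rewrite mul0r.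
by rewrite !lC.
Qed.

End ClosedFieldMPoly.

(** * Algebraic dependence *)

Section AlgebraicDependence.
Variable K : fieldType.

Lemma wide_mx_kernel m n (A : 'M[K]_(m, n)) :
  (n < m)%N -> exists2 u : 'rV_m, u != 0 & u *m A = 0.
Proof.
move=> ltnm; exists (nz_row (kermx A)).
  rewrite nz_row_eq0 -mxrank_eq0 mxrank_ker subn_eq0 -ltnNge.
  exact: leq_ltn_trans (rank_leq_col A) ltnm.
by apply/sub_kermxP; apply: nz_row_sub.
Qed.

Lemma mpoly_linear_dependence n N (I : finType) (F : I -> {mpoly K[n]}) :
    (forall i, msize (F i) <= N)%N -> (N ^ n < #|I|)%N ->
  exists2 u : I -> K, (exists i, u i != 0) & \sum_i u i *: F i = 0.
Proof.
move=> sF ltI; pose J := {ffun 'I_n -> 'I_N}.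
pose mono (f : J) : 'X_{1..n} := [multinom nat_of_ord (f i) | i < n].
pose A : 'M_(#|I|, #|J|) :=
  \matrix_(a, b) (F (enum_val a))@_(mono (enum_val b)).
have [|u un0 uA] := wide_mx_kernel A; first by rewrite card_ffun !card_ord.
exists (fun i => u 0 (enum_rank i)).
  by have /rV0Pn[a ua] := un0; exists (enum_val a); rewrite enum_valK.
apply/mpolyP => m; rewrite mcoeff0 raddf_sum /=.
have [ltm|] := boolP [forall i, m i < N]%N; last first.
  rewrite negb_forall => /existsP[i]; rewrite -leqNgt => lei.
  apply: big1 => j _; rewrite mcoeffZ memN_msupp_eq0 ?mulr0 //.
  apply: msize_mdeg_ge; apply: leq_trans (sF j) (leq_trans lei _).
  by rewrite mdegE (bigD1 i) //= leq_addr.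
pose f : J := [ffun i => Ordinal (forallP ltm i)].
have mf : mono f = m by apply/mnmP => i; rewrite mnmE ffunE.
have /matrixP/(_ 0 (enum_rank f)) := uA; rewrite mxE [RHS]mxE => uAf.
rewrite -[RHS]uAf (reindex_onto enum_val enum_rank) => [|i _]; last first.
  exact: enum_rankK.
apply: eq_big => a; rewrite ?enum_valK ?eqxx // mcoeffZ [A _ _]mxE.
by rewrite enum_rankK mf.
Qed.

(* The N ^ (n + 1) monomials with exponents < N in the given polynomials lie in
   a space of dimension O(N ^ n). *)
Lemma mpoly_algebraic_dependence n (lq : n.+1.-tuple {mpoly K[n]}) :
  exists2 G : {mpoly K[n.+1]}, G != 0 & G \mPo lq = 0.
Proof.
pose d := (\max_(i < n.+1) msize (tnth lq i))%N.
pose c := (n.+1 * d).+1; pose N := (c ^ n).+1.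
pose I := {ffun 'I_n.+1 -> 'I_N}.
pose mono (f : I) : 'X_{1..n.+1} := [multinom nat_of_ord (f i) | i < n.+1].
have mono_inj : injective mono.
  move=> f g /mnmP fg; apply/ffunP => i; apply: val_inj.
  by have := fg i; rewrite !mnmE.
have size_mono f : (msize ('X_[mono f] \mPo lq) <= c * N)%N.
  apply: leq_trans (msize_comp_mpolyX (d := d) _ _) _.
    by move=> i; apply: leq_trans (leqnSn _); apply: leq_bigmax.
  have : (mdeg (mono f) <= \sum_(i < n.+1) c ^ n)%N.
    by rewrite mdegE; apply: leq_sum => i _; rewrite mnmE -ltnS ltn_ord.
  rewrite sum_nat_const card_ord => /(leq_mul (leqnn d)).
  by rewrite /N; move: (mdeg _) (c ^ n)%N => m x; rewrite /c; nia.
have [|u [f uf] u0] := mpoly_linear_dependence size_mono.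
  by rewrite card_ffun !card_ord expnMn expnS ltn_pmul2r ?expn_gt0.
exists (\sum_f u f *: 'X_[mono f]); last first.
  by rewrite raddf_sum -[RHS]u0; apply: eq_bigr => g _; rewrite /= comp_mpolyZ.
apply: contraNneq uf => /mpolyP/(_ (mono f)).
rewrite raddf_sum mcoeff0 (bigD1 f) //= big1 ?addr0 => [|g gf].
  by rewrite mcoeffZ mcoeffX eqxx mulr1 => ->.
by rewrite mcoeffZ mcoeffX (inj_eq mono_inj) (negPf gf) mulr0.
Qed.

End AlgebraicDependence.

(** * Prime chains in subrings and localizations *)

Section Subring.
Variables (R : comNzRingType) (A : R -> Prop).
Implicit Types (I J : R -> Prop) (a b : R) (f : {poly R}).

Definition subring := [/\ A 1, forall a b, A a -> A b -> A (a - b) &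
  forall a b, A a -> A b -> A (a * b)].

Hypothesis subA : subring.

Lemma subring1 : A 1. Proof. by case: subA. Qed.

Lemma subringB a b : A a -> A b -> A (a - b).
Proof. by case: subA => _ AB _; apply: AB. Qed.

Lemma subringM a b : A a -> A b -> A (a * b).
Proof. by case: subA => _ _; apply. Qed.

Lemma subring0 : A 0.
Proof. by rewrite -(subrr 1); apply: subringB; apply: subring1. Qed.

Lemma subringN a : A a -> A (- a).
Proof. by rewrite -sub0r; apply: subringB; apply: subring0. Qed.

Lemma subringD a b : A a -> A b -> A (a + b).
Proof.
by move=> Aa Ab; rewrite -[b]opprK; apply: subringB => //; apply: subringN.
Qed.

Lemma subring_horner f a : (forall i, A f`_i) -> A a -> A f.[a].
Proof.
move=> Af Aa; rewrite horner_coef; apply: big_ind => [|x y|i _].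
- exact: subring0.
- exact: subringD.
apply: subringM => //; elim: (i : nat) => [|e IH].
  by rewrite expr0; apply: subring1.
by rewrite exprS; apply: subringM.
Qed.

Lemma ideal_ofB I a b : ideal_of A I -> I a -> I b -> I (a - b).
Proof.
case=> _ _ ID IM Ia Ib; apply: ID => //; rewrite -mulN1r; apply: IM => //.
exact/subringN/subring1.
Qed.

Lemma proper_ideal1 I : Defs.proper_ideal A I -> ~ I 1.
Proof.
case=> [[_ _ _ IM] [x [Ax nIx]]] I1; apply: nIx.
by rewrite -[x]mulr1; apply: IM.
Qed.

Lemma ideal_generated_by_mem I n (g : 'I_n -> R) i :
  ideal_generated_by A I g -> I (g i).
Proof.
case=> _ gP; apply/gP; exists (fun j => (j == i)%:R); split.
  by move=> j; case: (j == i); [apply: subring1 | apply: subring0].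
rewrite (bigD1 i) //= eqxx mul1r big1 ?addr0 // => j /negPf->.
by rewrite mul0r.
Qed.

Lemma maximal_ideal_units I : ideal_of A I -> ~ I 1 ->
    (forall a, A a -> ~ I a -> exists2 b, A b & b * a = 1) ->
  maximal_ideal A I.
Proof.
move=> idI nI1 inv; split.
  by split=> //; exists 1; split=> //; apply: subring1.
move=> J properJ subIJ a; split=> [Ja|]; last exact: subIJ.
apply: NNPP => nIa; apply: (proper_ideal1 properJ).
have [[JA _ _ JM] _] := properJ.
by have [b Ab <-] := inv a (JA a Ja) nIa; apply: JM.
Qed.

(* Lowest terms: since [a] is not in the prime [J], we may divide [f] by a power
   of ['X] and assume that its constant term is nonzero; that term is congruent
   to [f.[a]] modulo [I]. *)
Lemma prime_ideal_horner I J a f : ideal_of A I -> prime_ideal A J ->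
    (forall b, J b -> I b) -> I a -> ~ J a ->
    (forall i, A f`_i) -> (forall i, f`_i = 0 \/ ~ I f`_i) -> f != 0 ->
  ~ J f.[a].
Proof.
move=> idI [_ Jprime] subJI Ia nJa; have [IA _ _ IM] := idI.
elim/poly_ind: f => [|f c IH] Af nIf; first by rewrite eqxx.
have coef0 : (f * 'X + c%:P)`_0 = c by rewrite coefD coefMX coefC add0r.
have coefS i : (f * 'X + c%:P)`_i.+1 = f`_i by rewrite coefD coefMX coefC addr0.
have {coefS}[Af' nIf'] : (forall i, A f`_i) /\ (forall i, f`_i = 0 \/ ~ I f`_i).
  by split=> i; rewrite -coefS.
have fA : A f.[a] by apply: subring_horner => //; apply: IA.
rewrite hornerMXaddC; have := nIf 0%N; rewrite coef0 => -[->|nIc] fn0 Jfa.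
  rewrite addr0 in Jfa fn0; have [|//] := Jprime _ _ fA (IA _ Ia) Jfa.
  by apply: IH => //; apply: contraNneq fn0 => ->; rewrite mul0r addr0.
apply: nIc; have -> : c = f.[a] * a + c - f.[a] * a by rewrite addrC addKr.
by apply: ideal_ofB (IM _ _ fA Ia); last exact: subJI.
Qed.

End Subring.

Section PrimeChainIndependence.
Variables (K : fieldType) (R : comNzRingType) (f : {rmorphism K -> R}).
Variable A : R -> Prop.
Hypotheses (subA : subring A) (fA : forall x, A (f x)).

Lemma subring_mmap n (h : 'I_n -> R) (G : {mpoly K[n]}) :
  (forall i, A (h i)) -> A (mmap f h G).
Proof.
move=> Ah; elim/mpoly_ring_ind: G => [x|i|p q Ap Aq|p q Ap Aq].
- by rewrite mmapC; apply: fA.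
- by rewrite mmapX mmap1U.
- by rewrite mmapD; apply: subringD.
- by rewrite rmorphM; apply: subringM.
Qed.

Lemma descending_primes_independent n (p : nat -> R -> Prop) (a : 'I_n -> R)
    (G : {mpoly K[n]}) :
    (forall i, (i <= n)%N -> prime_ideal A (p i)) ->
    (forall i x, (i < n)%N -> p i.+1 x -> p i x) ->
    (forall i : 'I_n, p i (a i) /\ ~ p i.+1 (a i)) ->
  G != 0 -> ~ p n (mmap f a G).
Proof.
elim: n a G => [|n IH] a G primep subp pa Gn0.
  have [properp _] := primep 0%N isT; have [[_ _ _ pM] _] := properp.
  move: Gn0; rewrite (mpoly0_polyC G) mpolyC_eq0 mmapC => Gn0 pG.
  apply: (proper_ideal1 properp).
  by rewrite -(rmorph1 f) -(mulVf Gn0) rmorphM; apply: pM.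
pose widen := widen_ord (leqnSn n).
have primepn : prime_ideal A (p n) by apply: primep; rewrite leqW.
have [[pnideal _] _] := primepn; have [_ pn0 _ _] := pnideal.
have aA (i : 'I_n.+1) : A (a i).
  have [[[subpA _ _ _] _] _] := primep i (ltnW (ltn_ord i)).
  by apply: subpA; case: (pa i).
have npn g : g != 0 -> ~ p n (mmap f (fun i => a (widen i)) g).
  apply: IH => [i le|i x lt|i]; last exact: (pa (widen i)).
    exact/primep/leqW.
  exact/subp/ltnW.
have [pa0 npa] := pa ord_max.
rewrite mmap_muni; apply: (prime_ideal_horner subA pnideal (primep _ _)) => //.
- by move=> x; apply: subp.
- by move=> i; rewrite coef_map; apply: subring_mmap.
- move=> i; rewrite coef_map /=; have [->|gn0] := eqVneq (muni G)`_i 0.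
    by left; rewrite raddf0.
  by right; apply: npn.
- rewrite map_poly_eq0_id0 ?muni_eq0 //; apply/eqP => lc0.
  by apply: (npn (lead_coef (muni G))); rewrite ?lead_coef_eq0 ?muni_eq0 ?lc0.
Qed.

End PrimeChainIndependence.

Definition subalgebra (K : comNzRingType) k (A : {mpoly K[k]} -> Prop) :=
  subring A /\ forall x, A x%:MP.

Lemma subalgebra_prime_chain_leq (K : fieldType) k
    (A : {mpoly K[k]} -> Prop) d c :
  subalgebra A -> prime_chain A d c -> (d <= k)%N.
Proof.
move=> [subA constA] [primec chainc]; rewrite leqNgt; apply/negP => ltkd.
have step_ex (i : 'I_k.+1) :
    exists a, c (k.+1 - i)%N a /\ ~ c (k.+1 - i.+1)%N a.
  rewrite subSS subSn -1?ltnS //.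
  by apply: (chainc (k - i)%N _).2; apply: leq_ltn_trans (leq_subr i k) ltkd.
have [a ca] := fin_all_exists step_ex.
have [G Gn0 G0] := mpoly_algebraic_dependence [tuple a i | i < k.+1].
apply: (descending_primes_independent (f := @mpolyC k K) (A := A)
  (p := fun i => c (k.+1 - i)%N) (a := a) _ _ _ _ _ Gn0) => //.
- by move=> i _; apply: primec; apply: leq_trans (leq_subr _ _) ltkd.
- move=> i x lt; rewrite subSS subSn -1?ltnS //.
  by apply: (chainc (k - i)%N _).1; apply: leq_ltn_trans (leq_subr i k) ltkd.
rewrite subnn; have -> : mmap (@mpolyC k K) a G = 0.
  rewrite -[RHS]G0; apply: (@mpoly_rmorph_eq _ _ _ (mmap (@mpolyC k K) a)
    (comp_mpoly _)) => [x|i] /=; first by rewrite mmapC comp_mpolyC.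
  by rewrite mmapX mmap1U comp_mpolyX_tnth tnth_mktuple.
by have [[[_ c00 _ _] _] _] := primec 0%N isT.
Qed.

Section Localization.
Variables (R : idomainType) (S p : R -> Prop).
Hypotheses (subS : subring S) (prime_p : prime_ideal S p).
Implicit Types (a s : R) (z : {fraction R}).
Local Notation L := (localization S p).
Local Notation "a %:F" := (@tofrac R a).

Lemma prime_idealN1 : ~ p 1.
Proof. by case: prime_p => properp _; apply: proper_ideal1 properp. Qed.

Lemma prime_ideal_denomM s t : S s -> S t -> ~ p s -> ~ p t -> ~ p (s * t).
Proof. by case: prime_p => _ primep Ss St nps npt /primep[]. Qed.

Lemma prime_ideal_denom_neq0 s : ~ p s -> s%:F != 0.
Proof.
have [[[_ p0 _ _] _] _] := prime_p; rewrite tofrac_eq0 => nps.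
by apply/eqP => s0; rewrite s0 in nps.
Qed.

Lemma mem_localization a : S a -> L a%:F.
Proof.
move=> Sa; exists a, 1; split; rewrite ?rmorph1 ?divr1 //.
  exact: subring1.
exact: prime_idealN1.
Qed.

Lemma subring_localization : subring L.
Proof.
split.
- by rewrite -(rmorph1 (@tofrac R)); exact: mem_localization (subring1 subS).
- move=> _ _ [a [s [Sa Ss nps ->]]] [b [t [Sb St npt ->]]].
  exists (a * t - b * s), (s * t); split.
  + by apply: subringB => //; apply: subringM.
  + exact: subringM.
  + exact: prime_ideal_denomM.
  + rewrite -[- (b%:F / _)]mulNr addf_div ?prime_ideal_denom_neq0 //.
    by rewrite mulNr rmorphB !rmorphM.
- move=> _ _ [a [s [Sa Ss nps ->]]] [b [t [Sb St npt ->]]].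
  exists (a * b), (s * t); split; rewrite ?mulf_div ?rmorphM //.
  + exact: subringM.
  + exact: subringM.
  + exact: prime_ideal_denomM.
Qed.

Definition localization_ideal z :=
  exists a s, [/\ p a, S s, ~ p s & z = a%:F / s%:F].

Lemma ideal_of_localization_ideal : ideal_of L localization_ideal.
Proof.
have [[[pS p0 pD pM] _] _] := prime_p; have p1 := prime_idealN1.
split.
- by move=> _ [a [s [pa Ss nps ->]]]; exists a, s; split=> //; apply: pS.
- by exists 0, 1; rewrite rmorph0 mul0r; split=> //; apply: subring1.
- move=> _ _ [a [s [pa Ss nps ->]]] [b [t [pb St npt ->]]].
  exists (a * t + b * s), (s * t); split.
  + by rewrite [a * t]mulrC [b * s]mulrC; apply: pD; apply: pM.
  + exact: subringM.
  + exact: prime_ideal_denomM.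
  + by rewrite addf_div ?prime_ideal_denom_neq0 // rmorphD !rmorphM.
- move=> _ _ [a [s [Sa Ss nps ->]]] [b [t [pb St npt ->]]].
  exists (a * b), (s * t); split; rewrite ?mulf_div ?rmorphM //.
  + exact: pM.
  + exact: subringM.
  + exact: prime_ideal_denomM.
Qed.

Lemma localization_ideal_maximal : maximal_ideal L localization_ideal.
Proof.
apply: (maximal_ideal_units subring_localization ideal_of_localization_ideal).
  case=> a [s [pa _ nps e]]; apply: (nps); suff -> : s = a by [].
  apply/eqP; rewrite -tofrac_eq -[s%:F]mul1r e divfK //.
  exact: prime_ideal_denom_neq0.
move=> _ [a [s [Sa Ss nps ->]]] nIz.
have npa : ~ p a by move=> pa; apply: nIz; exists a, s.
exists (s%:F / a%:F); first by exists s, a.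
by rewrite mulf_div [s%:F * _]mulrC divff // mulf_neq0 ?prime_ideal_denom_neq0.
Qed.

Definition contraction (c : {fraction R} -> Prop) a := S a /\ c a%:F.

Lemma contraction_prime c : prime_ideal L c -> prime_ideal S (contraction c).
Proof.
move=> [properc cprime]; have [[_ c0 cD cM] _] := properc.
split; [split; [split|]|].
- by move=> a [].
- by split; [apply: subring0 | rewrite rmorph0].
- move=> a b [Sa ca] [Sb cb]; split; first exact: subringD.
  by rewrite rmorphD; apply: cD.
- move=> a b Sa [Sb cb]; split; first exact: subringM.
  by rewrite rmorphM; apply: cM => //; apply: mem_localization.
- exists 1; split; first exact: subring1.
  by case=> _; rewrite rmorph1; apply: proper_ideal1 properc.
- move=> a b Sa Sb [_]; rewrite rmorphM.
  case/(cprime _ _ (mem_localization Sa) (mem_localization Sb)) => ?.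
    by left.
  by right.
Qed.

Lemma contraction_proper c c' : ideal_of L c -> ideal_of L c' ->
    (exists z, c' z /\ ~ c z) ->
  exists a, contraction c' a /\ ~ contraction c a.
Proof.
move=> [_ _ _ cM] [c'L _ _ c'M] [z [c'z ncz]].
have [a [s [Sa Ss nps ez]]] := c'L z c'z; exists a; split.
  split=> //; have -> : a%:F = s%:F * z.
    by rewrite ez mulrC divfK ?prime_ideal_denom_neq0.
  by apply: c'M => //; apply: mem_localization.
case=> _ ca; apply: ncz; rewrite ez mulrC; apply: cM => //.
by exists 1, s; rewrite rmorph1 mul1r; split=> //; apply: subring1.
Qed.

Lemma prime_chain_contraction d c :
  prime_chain L d c -> prime_chain S d (fun i => contraction (c i)).
Proof.
case=> primec chainc; split=> i lei; first exact/contraction_prime/primec.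
have [subc ltc] := chainc i lei.
split; first by move=> a [Sa ca]; split=> //; apply: subc.
have [[[idc _] _] [[idcS _] _]] := (primec i (ltnW lei), primec i.+1 lei).
exact: contraction_proper ltc.
Qed.

End Localization.

(** * Gradients and Jacobian matrices *)

Section Gradient.
Variables (R : comNzRingType) (n : nat).
Implicit Types (p q : {mpoly R[n]}) (v : 'I_n -> R).

Definition gradient p : 'rV[{mpoly R[n]}]_n := \row_i p^`M(i).

Definition jacobian m (F : m.-tuple {mpoly R[n]}) : 'M[{mpoly R[n]}]_(m, n) :=
  \matrix_i gradient (tnth F i).

Definition gradient_at v p := map_mx (meval v) (gradient p).

Definition jacobian_at v m (F : m.-tuple {mpoly R[n]}) :=
  map_mx (meval v) (jacobian F).

Definition meval_tuple v m (F : m.-tuple {mpoly R[n]}) (i : 'I_m) : R :=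
  (tnth F i).@[v].

Lemma gradient_atE v p i : gradient_at v p 0 i = p^`M(i).@[v].
Proof. by rewrite !mxE. Qed.

Lemma row_jacobian_at v m (F : m.-tuple {mpoly R[n]}) i :
  row i (jacobian_at v F) = gradient_at v (tnth F i).
Proof. by rewrite -map_row rowK. Qed.

Lemma gradient0 : gradient 0 = 0.
Proof. by apply/rowP => i; rewrite !mxE mderiv0. Qed.

Lemma gradient_at0 v : gradient_at v 0 = 0.
Proof. by rewrite /gradient_at gradient0 map_mx0. Qed.

Lemma gradient_atC v x : gradient_at v x%:MP = 0.
Proof. by apply/rowP => i; rewrite !mxE mderivC meval0. Qed.

Lemma gradient_atX v i : gradient_at v 'X_i = delta_mx 0 i.
Proof.
by apply/rowP => j; rewrite !mxE mderivXU rmorph_nat eqxx eq_sym.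
Qed.

Lemma gradient_atD v p q :
  gradient_at v (p + q) = gradient_at v p + gradient_at v q.
Proof. by apply/rowP => i; rewrite !mxE mderivD mevalD. Qed.

Lemma gradient_atB v p q :
  gradient_at v (p - q) = gradient_at v p - gradient_at v q.
Proof. by apply/rowP => i; rewrite !mxE mderivB mevalB. Qed.

Lemma gradient_atM v p q :
  gradient_at v (p * q) = q.@[v] *: gradient_at v p + p.@[v] *: gradient_at v q.
Proof.
apply/rowP => i; rewrite !mxE mderivM mevalD !mevalM.
by rewrite [X in X + _]mulrC.
Qed.

End Gradient.

Section ChainRule.
Variables (R : comNzRingType) (m n : nat) (F : m.-tuple {mpoly R[n]}).
Implicit Types (w : {mpoly R[m]}) (v : 'I_n -> R).

Lemma gradient_comp w :
  gradient (w \mPo F) = map_mx (comp_mpoly F) (gradient w) *m jacobian F.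
Proof.
apply/rowP => i; rewrite !mxE mderiv_comp_mpoly.
by apply: eq_bigr => j _; rewrite !mxE.
Qed.

Lemma gradient_at_comp v w :
  gradient_at v (w \mPo F) = gradient_at (meval_tuple v F) w *m jacobian_at v F.
Proof.
rewrite /gradient_at gradient_comp map_mxM; congr (_ *m _).
by apply/rowP => i; rewrite !mxE; apply: comp_mpoly_meval.
Qed.

End ChainRule.

Lemma det_neq0_mulmx_eq0 (R : idomainType) n (A : 'M[R]_n) (u : 'rV_n) :
  \det A != 0 -> u *m A = 0 -> u = 0.
Proof.
move=> detA /(congr1 (mulmx^~ (\adj A))); rewrite -mulmxA mul_mx_adj mul0mx.
rewrite mul_mx_scalar => /rowP uA; apply/rowP => i; have := uA i.
by rewrite !mxE => /eqP; rewrite mulf_eq0 (negPf detA) => /eqP.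
Qed.

Lemma jacobian_algebraically_independent (R : idomainType) n
    (F : n.-tuple {mpoly R[n]}) (w : {mpoly R[n]}) :
  [pchar R] =i pred0 -> \det (jacobian F) != 0 -> w \mPo F = 0 -> w = 0.
Proof.
move=> charR0 detF; have [k] := ubnP (msize w); elim: k w => // k IH w lt wF.
apply/eqP/negPn/negP => wn0; have dw i : w^`M(i) = 0.
  apply: IH; first by apply: leq_trans (msize_mderiv_lt i wn0) _; rewrite -ltnS.
  have := gradient_comp F w; rewrite wF gradient0 => /esym.
  by move/(det_neq0_mulmx_eq0 detF)/rowP/(_ i); rewrite !mxE.
move: wF wn0; rewrite (mderiv_eq0_polyC charR0 dw) comp_mpolyC => ->.
by rewrite eqxx.
Qed.

Section JacobianUnit.
Variables (K : fieldType) (n : nat) (F : n.-tuple {mpoly K[n]}).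
Hypothesis unitJF : jacobian F \in unitmx.

Lemma jacobian_at_unitmx v : jacobian_at v F \in unitmx.
Proof. by rewrite unitmxE det_map_mx rmorph_unit. Qed.

Lemma relation_gradient_eq0 z (H : {mpoly K[n.+1]}) v
    (G := [tuple of rcons F z]) : H \mPo G = 0 ->
  (H^`M(ord_max) \mPo G).@[v] = 0 -> gradient_at (meval_tuple v G) H = 0.
Proof.
move=> HG; rewrite comp_mpoly_meval => dHmax.
pose u : 'rV_n :=
  \row_i gradient_at (meval_tuple v G) H 0 (widen_ord (leqnSn n) i).
have u0 : u = 0.
  apply: (can_inj (mulmxK (jacobian_at_unitmx v))); rewrite mul0mx.
  apply/rowP => j; transitivity
    ((gradient_at (meval_tuple v G) H *m jacobian_at v G) 0 j); last first.
    by rewrite -gradient_at_comp HG gradient_at0.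
  rewrite [LHS]mxE [RHS]mxE big_ord_recr /= gradient_atE dHmax mul0r addr0.
  by apply: eq_bigr => i _; rewrite !mxE tnth_rcons_widen.
apply/rowP => i; rewrite [RHS]mxE; case: (ord_max_or_widen i) => [->|[j ->]].
  by rewrite gradient_atE.
by move/rowP/(_ j): u0; rewrite !mxE.
Qed.

End JacobianUnit.

(** * Nonsingular points of the image of a polynomial map *)

Definition gen_subalg (R : comNzRingType) n k (F : n.-tuple {mpoly R[k]}) b :=
  exists g : {mpoly R[n]}, b = g \mPo F.

(* When [n = k + 1] and [F] has transcendence degree [k], this is the Jacobian
   criterion at the image of [v]; in general it only says that the embedding
   dimension there is less than [n]. *)
Definition nonsingular_at (R : comNzRingType) n k
    (F : n.-tuple {mpoly R[k]}) v :=
  exists2 H : {mpoly R[n]}, H \mPo F = 0 & gradient_at (meval_tuple v F) H != 0.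

Section GeneratedSubalgebra.
Variables (R : comNzRingType) (n k : nat) (F : n.-tuple {mpoly R[k]}).

Lemma gen_subalg_subalgebra : subalgebra (gen_subalg F).
Proof.
split; [split=> [|_ _ [g ->] [h ->]|_ _ [g ->] [h ->]] | move=> x].
- by exists 1; rewrite comp_mpoly1.
- by exists (g - h); rewrite comp_mpolyB.
- by exists (g * h); rewrite comp_mpolyM.
- by exists x%:MP; rewrite comp_mpolyC.
Qed.

Lemma gen_subalg_rcons z b :
  gen_subalg F b -> gen_subalg [tuple of rcons F z] b.
Proof. by case=> g ->; exists (mwiden g); rewrite mwiden_comp_rcons. Qed.

Lemma gen_subalg_rcons_last z : gen_subalg [tuple of rcons F z] z.
Proof. by exists 'X_ord_max; rewrite comp_mpolyX_tnth tnth_rcons_max. Qed.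

Lemma gen_subalg_right_inverse : (forall i, gen_subalg F 'X_i) ->
  exists L : k.-tuple {mpoly R[n]}, forall p, (p \mPo L) \mPo F = p.
Proof.
move=> XF; have [l Xl] := fin_all_exists XF.
exists [tuple l i | i < k] => p; rewrite comp_mpolyA -[RHS]comp_mpoly_id.
by congr (_ \mPo _); apply: eq_from_tnth => i; rewrite !tnth_mktuple.
Qed.

End GeneratedSubalgebra.

Lemma jacobian_nonsingular_mem (K : closedFieldType) n
    (F : n.-tuple {mpoly K[n]}) z :
    [pchar K] =i pred0 -> jacobian F \in unitmx ->
    (forall v, nonsingular_at [tuple of rcons F z] v) ->
  gen_subalg F z.
Proof.
set G := [tuple of _] => charK0 unitJF nonsing.
have F_inj (w : {mpoly K[n]}) : comp_mpoly G (mwiden w) = 0 -> w = 0.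
  rewrite mwiden_comp_rcons; apply: jacobian_algebraically_independent => //.
  by apply: contraTneq unitJF; rewrite unitmxE => ->; rewrite unitr0.
have [H Hn0 HG] := mpoly_algebraic_dependence G.
have [h [hn0 hnu _] kerG] := rmorph_kernel_principal F_inj Hn0 HG.
have hG : h \mPo G = 0 by apply/kerG; exists 1; rewrite mul1r.
have [v|e en0 dhG] := @mpoly_nonvanishing_const K n (h^`M(ord_max) \mPo G).
  have [H' /kerG[k ->]] := nonsing v; apply: contraNneq.
  move/(relation_gradient_eq0 unitJF hG) => gradh.
  rewrite gradient_atM gradh scaler0 -comp_mpoly_meval hG meval0.
  by rewrite scale0r addr0.
have dh : h^`M(ord_max) = e%:MP.
  apply: divides_mderivB_const => //; apply/kerG.
  by rewrite /= comp_mpolyB dhG comp_mpolyC subrr.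
have [w hw] := mderiv_max_const charK0 dh.
move: hG; rewrite hw comp_mpolyD mwiden_comp_rcons comp_mpolyZ.
rewrite comp_mpolyX_tnth tnth_rcons_max => /eqP; rewrite addr_eq0 => /eqP zE.
exists (- e^-1 *: w).
by rewrite comp_mpolyZ scaleNr -scalerN -zE scalerA mulVf // scale1r.
Qed.

(* If every relation were singular at [v], then composing with lifts [L] of the
   coordinates would factor the identity of rank [n] through rank [k]. *)
Lemma generators_nonsingular (K : fieldType) n k (F : n.-tuple {mpoly K[k]}) v :
  (k < n)%N -> (forall i, gen_subalg F 'X_i) -> nonsingular_at F v.
Proof.
move=> ltkn /gen_subalg_right_inverse[L LK]; apply: NNPP => sing.
have gradF i : gradient_at (meval_tuple v F) 'X_i =
    gradient_at (meval_tuple v F) (tnth F i \mPo L).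
  apply/eqP; rewrite -subr_eq0 -gradient_atB; apply/negPn/negP => grad.
  apply: sing; exists ('X_i - (tnth F i \mPo L)) => //.
  by rewrite comp_mpolyB LK comp_mpolyX_tnth subrr.
have id_factor : 1%:M = jacobian_at (meval_tuple (meval_tuple v F) L) F
    *m jacobian_at (meval_tuple v F) L.
  apply/row_matrixP => i; rewrite row1 -(gradient_atX (meval_tuple v F)) gradF.
  by rewrite gradient_at_comp row_mul row_jacobian_at.
have := mulmx_max_rank (jacobian_at (meval_tuple (meval_tuple v F) L) F)
  (jacobian_at (meval_tuple v F) L).
by rewrite -id_factor mxrank1 leqNgt ltkn.
Qed.

Lemma jacobian_generators_bijective (R : idomainType) n
    (F : n.-tuple {mpoly R[n]}) :
    [pchar R] =i pred0 -> \det (jacobian F) != 0 ->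
    (forall i, gen_subalg F 'X_i) ->
  bijective (comp_mpoly F).
Proof.
move=> charR0 detF /gen_subalg_right_inverse[L LK].
exists (comp_mpoly L) => // p.
apply/eqP; rewrite -subr_eq0; apply/eqP.
apply: (jacobian_algebraically_independent charR0 detF).
by rewrite comp_mpolyB LK subrr.
Qed.

(** * Embedding dimension of the local ring at a point *)

Section PointLocalization.
Variables (K : fieldType) (n k : nat).
Variables (F : n.-tuple {mpoly K[k]}) (v : 'I_k -> K).
Local Notation S := (gen_subalg F).
Local Notation "x %:F" := (@tofrac {mpoly K[k]} x).
Local Notation Fv := (meval_tuple v F).

Definition point_ideal b := S b /\ b.@[v] = 0.

Local Notation L := (localization S point_ideal).
Local Notation m := (localization_ideal S point_ideal).

Lemma point_ideal_prime : prime_ideal S point_ideal.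
Proof.
have [subS _] := gen_subalg_subalgebra F; split; [split; [split|]|].
- by move=> b [].
- by split; [apply: subring0 | rewrite meval0].
- move=> a b [Sa a0] [Sb b0]; split; first exact: subringD.
  by rewrite mevalD a0 b0 addr0.
- move=> a b Sa [Sb b0]; split; first exact: subringM.
  by rewrite mevalM b0 mulr0.
- exists 1; split; first exact: subring1.
  by case=> _ /eqP; rewrite meval1 oner_eq0.
- move=> a b Sa Sb [_ /eqP]; rewrite mevalM mulf_eq0.
  by case/orP=> /eqP ?; [left | right].
Qed.

Lemma not_point_ideal (s : {mpoly K[n]}) :
  ~ point_ideal (s \mPo F) <-> s.@[Fv] != 0.
Proof.
rewrite -comp_mpoly_meval; split=> [nps|sv [_ s0]].
  by apply/eqP => s0; apply: nps; split=> //; exists s.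
by rewrite s0 eqxx in sv.
Qed.

Lemma comp_mpoly_denom_neq0 (s : {mpoly K[n]}) :
  s.@[Fv] != 0 -> (s \mPo F)%:F != 0.
Proof.
rewrite tofrac_eq0 -comp_mpoly_meval.
by apply: contraNneq => ->; rewrite meval0.
Qed.

Lemma point_localizationP z : L z <->
  exists a s : {mpoly K[n]}, s.@[Fv] != 0 /\ z = (a \mPo F)%:F / (s \mPo F)%:F.
Proof.
split=> [[_ [_ [[a ->] [s ->] /not_point_ideal sv ->]]]|[a [s [sv ->]]]].
  by exists a, s.
exists (a \mPo F), (s \mPo F); split; [by exists a | by exists s | | by []].
exact/not_point_ideal.
Qed.

(* The differential at [v] of an element of the maximal ideal of the local ring,
   computed on a fraction of lifts to the polynomial ring. *)
Definition local_differential z (d : 'rV[K]_n) :=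
  exists a s : {mpoly K[n]}, [/\ a.@[Fv] = 0, s.@[Fv] != 0,
    z = (a \mPo F)%:F / (s \mPo F)%:F & d = (s.@[Fv])^-1 *: gradient_at Fv a].

Lemma local_differential_lift (a : {mpoly K[n]}) :
  a.@[Fv] = 0 -> local_differential (a \mPo F)%:F (gradient_at Fv a).
Proof.
move=> a0; exists a, 1; rewrite meval1 oner_neq0 comp_mpoly1 rmorph1.
by rewrite divr1 invr1 scale1r.
Qed.

Lemma localization_ideal_local_differential z :
  m z <-> exists d, local_differential z d.
Proof.
split=> [[_ [_ [[[a ->] a0] [s ->] /not_point_ideal sv ->]]]|].
  by exists ((s.@[Fv])^-1 *: gradient_at Fv a), a, s; rewrite -comp_mpoly_meval.
case=> _ [a [s [a0 sv -> _]]]; exists (a \mPo F), (s \mPo F); split=> //.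
- by split; [exists a | rewrite comp_mpoly_meval].
- by exists s.
- exact/not_point_ideal.
Qed.

Lemma local_differentialD z1 z2 d1 d2 :
  local_differential z1 d1 -> local_differential z2 d2 ->
  local_differential (z1 + z2) (d1 + d2).
Proof.
case=> a [s [a0 sv -> ->]] [b [t [b0 tv -> ->]]].
exists (a * t + b * s), (s * t); split.
- by rewrite mevalD !mevalM a0 b0 !mul0r addr0.
- by rewrite mevalM mulf_neq0.
- rewrite addf_div ?comp_mpoly_denom_neq0 // comp_mpolyD !comp_mpolyM.
  by rewrite rmorphD !rmorphM.
rewrite gradient_atD !gradient_atM a0 b0 !scale0r !addr0 mevalM.
rewrite scalerDr !scalerA.
by congr (_ *: _ + _ *: _); field; apply/andP.
Qed.

Lemma local_differentialM x z d : L x -> local_differential z d ->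
  exists e : K, local_differential (x * z) (e *: d).
Proof.
case/point_localizationP=> b [t [tv ->]] [a [s [a0 sv -> ->]]].
exists (b.@[Fv] / t.@[Fv]), (b * a), (t * s); split.
- by rewrite mevalM a0 mulr0.
- by rewrite mevalM mulf_neq0.
- by rewrite mulf_div !comp_mpolyM !rmorphM.
rewrite gradient_atM a0 scale0r add0r mevalM !scalerA.
by congr (_ *: _); field; apply/andP.
Qed.

Hypothesis singular : ~ nonsingular_at F v.

Lemma local_differential_uniq z d e :
  local_differential z d -> local_differential z e -> d = e.
Proof.
case=> a [s [a0 sv -> ->]] [b [t [b0 tv eab ->]]].
have rel : (a * t - b * s) \mPo F = 0.
  apply/eqP; rewrite comp_mpolyB subr_eq0 -tofrac_eq !comp_mpolyM !rmorphM /=.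
  by move/eqP: eab; rewrite eqr_div ?comp_mpoly_denom_neq0.
have : gradient_at Fv (a * t - b * s) = 0.
  by apply/eqP/negPn/negP => grad; apply: singular; exists (a * t - b * s).
rewrite gradient_atB !gradient_atM a0 b0 !scale0r !addr0 => /eqP.
rewrite subr_eq0 => /eqP grad_eq; rewrite -[gradient_at Fv a](scalerK tv).
by rewrite grad_eq !scalerA mulrAC mulVf // mul1r.
Qed.

Lemma local_differential_sum r (g : 'I_r -> {fraction {mpoly K[k]}})
    (x : 'I_r -> {fraction {mpoly K[k]}}) (D : 'M[K]_(r, n)) :
    (forall j, L (x j)) -> (forall j, local_differential (g j) (row j D)) ->
  exists2 e, (e <= D)%MS & local_differential (\sum_j x j * g j) e.
Proof.
move=> Lx gD; pose spanned z := exists2 e, (e <= D)%MS & local_differential z e.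
apply: (big_ind spanned) => [|z1 z2 [e1 e1D e1P] [e2 e2D e2P]|j _].
- exists 0; first exact: sub0mx.
  have := local_differential_lift (meval0 Fv).
  by rewrite comp_mpoly0 rmorph0 gradient_at0.
- by exists (e1 + e2); [apply: addmx_sub | apply: local_differentialD].
have [e eP] := local_differentialM (Lx j) (gD j).
by exists (e *: row j D); rewrite ?scalemx_sub ?row_sub.
Qed.

Lemma singular_embedding_dim r (g : 'I_r -> {fraction {mpoly K[k]}}) :
  ideal_generated_by L m g -> (n <= r)%N.
Proof.
have [subS _] := gen_subalg_subalgebra F.
have subL := subring_localization subS point_ideal_prime.
move=> gen; have [_ gP] := gen.
have gD j : exists d, local_differential (g j) d.
  apply/localization_ideal_local_differential.
  exact: (ideal_generated_by_mem subL).
have [d dP] := fin_all_exists gD.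
pose D : 'M[K]_(r, n) := \matrix_j d j.
suff /mxrankS : (1%:M <= D)%MS.
  by rewrite mxrank1 => /leq_trans; apply; apply: rank_leq_row.
apply/row_subP => i; pose l : {mpoly K[n]} := 'X_i - (Fv i)%:MP.
have l0 : l.@[Fv] = 0 by rewrite mevalB mevalXU mevalC subrr.
have dl := local_differential_lift l0.
have /gP[x [Lx el]] : m (l \mPo F)%:F.
  by apply/localization_ideal_local_differential; exists (gradient_at Fv l).
have [|e eD eP] := @local_differential_sum _ g x D Lx.
  by move=> j; rewrite rowK.
have -> // : row i 1%:M = e.
rewrite row1 -(gradient_atX Fv); apply: local_differential_uniq eP.
by move: dl; rewrite el gradient_atB gradient_atC subr0.
Qed.

End PointLocalization.

Lemma regular_nonsingular (K : fieldType) n k (F : n.-tuple {mpoly K[k]}) v :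
  (k < n)%N -> regular_ring (gen_subalg F) -> nonsingular_at F v.
Proof.
move=> ltkn [_ regular]; apply: NNPP => singular.
have [subS _] := gen_subalg_subalgebra F; have primev := point_ideal_prime F v.
have [_ [m [[_ m_uniq] dim]]] := regular _ primev.
have [d [[[c chain] _] [[g [gL gP]] _]]] := dim.
have mE := m_uniq _ (localization_ideal_maximal subS primev).
have /(singular_embedding_dim singular) len : ideal_generated_by
    (localization (gen_subalg F) (point_ideal F v))
    (localization_ideal (gen_subalg F) (point_ideal F v)) g.
  by split=> // x; rewrite mE; apply: gP.
have := subalgebra_prime_chain_leq (gen_subalg_subalgebra F)
  (prime_chain_contraction subS primev chain).
by rewrite leqNgt (leq_trans ltkn len).
Qed.

(** * The plane *)

Lemma forall_ord2 (T : 'I_2 -> Prop) : T X0 -> T X1 -> forall i, T i.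
Proof.
move=> T0 T1 [[|[|//]] lt].
  by have -> : Ordinal lt = X0 by apply: val_inj.
by have -> : Ordinal lt = X1 by apply: val_inj.
Qed.

Lemma det_mx2 (R : comNzRingType) (A : 'M[R]_2) :
  \det A = A X0 X0 * A X1 X1 - A X0 X1 * A X1 X0.
Proof.
rewrite (expand_det_row _ X0) !big_ord_recl big_ord0 /cofactor !det_mx11 !mxE.
rewrite addr0 expr0 expr1 mul1r mulN1r mulrN.
by congr (A _ _ * A _ _ - A _ _ * A _ _); apply: val_inj.
Qed.

Lemma det_jacobian2 (R : comNzRingType) (P Q : {mpoly R[2]}) :
  \det (jacobian [tuple P; Q]) = jac2 P Q.
Proof. by rewrite det_mx2 !mxE. Qed.

Theorem theorem4p1 (K : closedFieldType) (charK0 : [pchar K] =i pred0)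
  (P Q : {mpoly K[2]}) (c : K) (hc : c != 0)
  (hjac : jac2 P Q = c%:MP)
  (hreg : regular_ring (subalg_PQxy P Q)) :
  bijective (endo2 P Q).
Proof.
pose F := [tuple P; Q]; have [subF _] := gen_subalg_subalgebra F.
have unitJF : jacobian F \in unitmx.
  by rewrite unitmxE det_jacobian2 hjac mpolyC_neq0_unit.
have X1E : 'X_X1 = 'X_X0 + 'X_X1 - 'X_X0 :> {mpoly K[2]} by rewrite addrC addKr.
have F_sum : gen_subalg F ('X_X0 + 'X_X1).
  apply: (jacobian_nonsingular_mem charK0 unitJF) => v.
  rewrite (_ : [tuple of _] = [tuple P; Q; 'X_X0 + 'X_X1]); last exact: val_inj.
  exact: regular_nonsingular.
have F_X0 : gen_subalg F 'X_X0.
  apply: (jacobian_nonsingular_mem charK0 unitJF) => v.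
  have [subFX _] := gen_subalg_subalgebra [tuple of rcons F 'X_X0].
  apply: generators_nonsingular => //; apply: forall_ord2.
    exact: gen_subalg_rcons_last.
  rewrite X1E; apply: subringB (gen_subalg_rcons_last _ _) => //.
  exact: gen_subalg_rcons.
apply: (jacobian_generators_bijective charK0).
  by rewrite det_jacobian2 hjac mpolyC_eq0.
by apply: forall_ord2 => //; rewrite X1E; apply: subringB.
Qed.
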